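(* For each integer $p\geq 1$ let $$\bar g^K(x;p)=\max\Big\{\sum_{k=1}^K w_kg(v_k,x)\ :\ \sum_{k=1}^K w_k\|v_k-d_k\|^p\le\epsilon^p,\ v_k\in S,\ k=1,\dots,K\Big\},$$ and let $$g^{\epsilon}(d,x)=\max\{g(v,x)\mid v\in S,\ \|v-d\|\le\epsilon\}.$$ Let the functions $\epsilon\mapsto g^\epsilon(d_k,x)$ be continuous for all $k=1,\dots,K$. Then $$\bar g^K(x;\infty):=\lim_{p\to\infty}\bar g^K(x;p)=\sum_{k=1}^K w_kg^{\epsilon}(d_k,x).$$
   Context: $S\subseteq\mathbf{R}^m$ is convex and closed; for all $x\in\mathcal X\subseteq\mathbf{R}^n$ ($\mathcal X$ compact) the function $u\mapsto-g(u,x)$ is proper, convex and lower-semicontinuous, with domain containing $S$. $\|\cdot\|$ is a norm on $\mathbf{R}^m$, $\epsilon>0$. The points $d_1,\dots,d_K\in S$ are the centroids of the $K$ nonempty clusters $C_1,\dots,C_K$ into which a data set of $N$ points of $S$ is partitioned, and $w_k=|C_k|/N>0$, so $\sum_k w_k=1$. *)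

(* Defs.v *)
From HB Require Import structures.
From mathcomp Require Import all_boot all_order all_algebra.
From mathcomp Require Import all_classical all_reals all_analysis.

Set Implicit Arguments.
Unset Strict Implicit.
Unset Printing Implicit Defensive.

Import Order.TTheory GRing.Theory Num.Theory.
Import numFieldNormedType.Exports.

Local Open Scope classical_set_scope.
Local Open Scope ring_scope.

(* An arbitrary norm on a vector space. On 'rV[R]_m the library's own `|_| is
   the sup norm; it is used only through the topology that it induces. *)
Definition is_norm (R : realType) (V : lmodType R) (nrm : V -> R) : Prop :=
  [/\ forall u v, nrm (u + v) <= nrm u + nrm v,
      forall (a : R) u, nrm (a *: u) = `|a| * nrm u
    & forall u, nrm u = 0 -> u = 0].

(* Convex analysis of functions with values in [-oo, +oo]. *)
Definition edom (R : realType) (V : Type) (f : V -> \bar R) : set V :=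
  [set u | (f u < +oo)%E].

Definition proper_efun (R : realType) (V : Type) (f : V -> \bar R) : Prop :=
  (forall u, (-oo < f u)%E) /\ edom f !=set0.

(* Meant for functions that never take the value -oo (proper ones), for which
   no sum +oo + -oo, which the library sets to -oo, occurs on the right. *)
Definition convex_efun (R : realType) (V : lmodType R) (f : V -> \bar R) :
    Prop :=
  forall (u v : V) (t : R), 0 < t -> t < 1 ->
    (f (t *: u + (1 - t) *: v)%R <= t%:E * f u + (1 - t)%:E * f v)%E.

(* The data points are indexed by 'I_N, so they may repeat, and the clusters
   are sets of indices. *)
Definition is_clustering (N K : nat) (C : 'I_K -> {set 'I_N}) : Prop :=
  [/\ forall k, (0 < #|C k|)%N,
      forall k l i, i \in C k -> i \in C l -> k = l
    & forall i, exists k, i \in C k].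

Definition centroid (R : realType) (V : lmodType R) (N : nat) (y : 'I_N -> V)
    (A : {set 'I_N}) : V :=
  (#|A|%:R : R)^-1 *: \sum_(i in A) y i.

Definition weight (R : realType) (N : nat) (A : {set 'I_N}) : R :=
  #|A|%:R / N%:R.

Section robust_values.
Variables (R : realType) (m n : nat).
Variables (nrm : 'rV[R]_m -> R) (S : set 'rV[R]_m).
Variable g : 'rV[R]_m -> 'rV[R]_n -> \bar R.

Definition ball_values (d : 'rV[R]_m) (x : 'rV[R]_n) (eps : R) :
    set (\bar R) :=
  [set g v x | v in [set v | S v /\ nrm (v - d) <= eps]].

Definition clustered_values (K : nat) (w : 'I_K -> R) (d : 'I_K -> 'rV[R]_m)
    (eps : R) (x : 'rV[R]_n) (p : nat) : set (\bar R) :=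
  [set (\sum_(k < K) (w k)%:E * g (v k) x)%E
    | v in [set v : 'I_K -> 'rV[R]_m |
        \sum_(k < K) w k * nrm (v k - d k) ^+ p <= eps ^+ p
        /\ forall k, S (v k)]].

(* The two maxima are defined as suprema in [-oo, +oo]; that a supremum of
   A is a maximum is the assertion [attained A]. *)
Definition g_eps (d : 'rV[R]_m) (x : 'rV[R]_n) (eps : R) : \bar R :=
  ereal_sup (ball_values d x eps).

Definition g_bar (K : nat) (w : 'I_K -> R) (d : 'I_K -> 'rV[R]_m)
    (eps : R) (x : 'rV[R]_n) (p : nat) : \bar R :=
  ereal_sup (clustered_values w d eps x p).

End robust_values.

Definition attained (R : realType) (A : set (\bar R)) : Prop :=
  A (ereal_sup A).

(* Main.v *)
Require Import Defs.
From HB Require Import structures.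
From mathcomp Require Import all_boot all_order all_algebra.
From mathcomp Require Import all_classical all_reals all_analysis.
From mathcomp Require Import ring lra.

Set Implicit Arguments.
Unset Strict Implicit.
Unset Printing Implicit Defensive.

Import Order.TTheory GRing.Theory Num.Theory.
Import numFieldNormedType.Exports.

Local Open Scope classical_set_scope.
Local Open Scope ring_scope.

(** The p-th powered budget [\sum_k w k * nrm (v k - d k) ^+ p <= eps ^+ p]
turns, as p grows, into the K separate constraints [nrm (v k - d k) <= eps].

On one side, since the weights sum to 1, any choice of points in the K balls of
radius [eps] meets the budget, so the clustered value is at least the
weighted sum of the values on these balls ([g_bar_ge]). On the other side, each
single term of the budget is at most [eps ^+ p], which puts [v k] in the ball of
radius [eps * w k `^ (- p^-1)] around [d k]; the clustered value is therefore at
most the weighted sum of the values on these larger balls ([g_bar_le]). The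
radii tend to [eps], so continuity in the radius squeezes the limit
([cvg_g_bar]).

That the suprema are maxima is the extreme value theorem for upper
semicontinuous functions ([attained_usc]): balls of an arbitrary norm are
compact because all norms on row vectors are equivalent
([norm_ball_compact]), and the set allowed by the budget is closed in the
product of the K balls just described, which is compact by Tychonoff's theorem
([clustered_attained]). Maxima in [S] also give finite values, so the limit of
the weighted sum can be taken term by term. Convexity of [S] serves to place
the centroids in [S] ([convex_mean]). *)

(** * Extended real functions *)

Lemma lte_real_dense (R : realType) (a b : \bar R) :
  (a < b)%E -> exists c : R, (a < c%:E)%E /\ (c%:E < b)%E.
Proof.
case: a b => [a| |] [b| |] //=; rewrite ?lte_fin => ab.
- by exists ((a + b) / 2); rewrite !lte_fin midf_lt// ?midf_lt.
- by exists (a + 1); rewrite lte_fin ltrDl ltr01 ltry.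
- by exists (b - 1); rewrite lte_fin gtrBl ltr01 ltNyr.
- by exists 0; rewrite ltry ltNyr.
Qed.

(** If no point reached the supremum s, each point would have a neighbourhood on
which f stays below some c < s; by compactness a single bound below s would hold
on all of A. The compactness is used in its near-covering form, for the filter
of left neighbourhoods of s. *)
Lemma attained_usc (R : realType) (T : topologicalType) (A : set T)
    (f : T -> \bar R) :
  A !=set0 -> compact A -> lower_semicontinuous (fun x => - f x)%E ->
  attained (f @` A).
Proof.
move=> [x0 Ax0] /compact_near_coveringP cA f_usc; rewrite /attained.
set s := ereal_sup _; apply: contrapT => nsA.
have fs x : A x -> (f x < s)%E.
  move=> Ax; rewrite lt_neqAle ereal_sup_ubound ?andbT; last by exists x.
  by apply/eqP => fxs; apply: nsA; exists x.
(* F is a filter because it has a base element, given by f x0 < s. *)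
pose F := filter_from [set a | (a < s)%E] (fun a => [set b | (a <= b < s)%E]).
have FF : ProperFilter F.
  apply: filter_from_proper => [|a /= a_s]; last first.
    by exists a; rewrite /= lexx.
  apply: filter_from_filter; first by exists (f x0); apply: fs.
  move=> a b /= a_s b_s; exists (Order.max a b); first by rewrite /= gt_max a_s.
  by move=> c /=; rewrite ge_max => /andP[/andP[-> ->] ->].
have : \near F, A `<=` [set x | (f x < F)%E].
  apply: cA => x Ax.
  have [c [fc cs]] := lte_real_dense (fs _ Ax).
  have [|V Vx Vf] := f_usc x (- c); first by rewrite EFinN lteN2.
  exists (V, [set b | (c%:E <= b < s)%E]); first by split => //; exists c%:E.
  move=> [z b] [/= /Vf + /andP[cb _]].
  by rewrite EFinN lteN2 => /lt_le_trans; apply.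
move=> [a /= a_s /(_ a)]; rewrite /= lexx => /(_ a_s) Aa.
have : (s <= a)%E by apply: ge_ereal_sup => _ [x /Aa/ltW ? <-].
by rewrite leNgt a_s.
Qed.

Lemma lsc_comp (R : realType) (T U : topologicalType) (u : T -> U)
    (f : U -> \bar R) :
  continuous u -> lower_semicontinuous f -> lower_semicontinuous (f \o u).
Proof.
move=> u_cont f_lsc x a /= /f_lsc [V Vx Vf].
by exists (u @^-1` V) => [|z /Vf//]; exact: u_cont.
Qed.

Lemma lsc_scale (R : realType) (T : topologicalType) (c : R)
    (f : T -> \bar R) :
  0 < c -> lower_semicontinuous f ->
  lower_semicontinuous (fun x => c%:E * f x)%E.
Proof.
move=> c_gt0 f_lsc x a; rewrite -lte_pdivrMl// -EFinM => /f_lsc[V Vx Vf].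
by exists V => // z /Vf; rewrite EFinM lte_pdivrMl.
Qed.

Lemma lsc_add (R : realType) (T : topologicalType) (f g : T -> \bar R) :
  lower_semicontinuous f -> lower_semicontinuous g ->
  lower_semicontinuous (f \+ g)%E.
Proof.
move=> f_lsc g_lsc x a /= afg.
(* The bound a is split as b + (a - b), leaving each summand some slack. *)
have [b [bf abg]] : exists b : R, (b%:E < f x)%E /\ ((a - b)%:E < g x)%E.
  move: afg; case: (f x) (g x) => [r| |] [q| |] //=.
  - rewrite lte_fin => arq; exists (r - (r + q - a) / 2).
    by rewrite !lte_fin; split; lra.
  - by exists (r - 1); rewrite ltry lte_fin gtrBl.
  - by exists (a - q + 1); rewrite ltry lte_fin; split => //; lra.
  - by exists 0; rewrite !ltry.
have [V Vx Vf] := f_lsc _ _ bf; have [W Wx Wg] := g_lsc _ _ abg.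
exists (V `&` W) => [|z [/Vf bz /Wg az]]; first exact: filterI.
by rewrite -[a](subrKC b) EFinD lteD.
Qed.

Lemma lsc_sum (R : realType) (T : topologicalType) (I : Type) (r : seq I)
    (f : I -> T -> \bar R) :
  (forall i, lower_semicontinuous (f i)) ->
  lower_semicontinuous (fun x => \sum_(i <- r) f i x)%E.
Proof.
move=> f_lsc; elim: r => [|i r IHr].
  move=> x a; rewrite big_nil => a0; exists setT; first exact: filterT.
  by move=> z _; rewrite big_nil.
have -> : (fun x => \sum_(j <- i :: r) f j x)%E =
    (f i \+ (fun x => \sum_(j <- r) f j x))%E.
  by apply/funext => x; rewrite big_cons.
exact: lsc_add.
Qed.

Lemma cvge_sum (R : realFieldType) (T : Type) (F : set_system T)
    (FF : Filter F) (I : Type) (r : seq I) (f : I -> T -> \bar R)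
    (l : I -> \bar R) :
  (forall i, l i \is a fin_num) -> (forall i, f i @ F --> l i) ->
  (\sum_(i <- r) f i t)%E @[t --> F] --> (\sum_(i <- r) l i)%E.
Proof.
move=> l_fin fl; elim: r => [|i r IHr].
  by rewrite big_nil; under eq_fun do rewrite big_nil; exact: cvg_cst.
rewrite big_cons; under eq_fun do rewrite big_cons.
by apply: cvgeD => //; rewrite fin_num_adde_defr.
Qed.

(** * Centroids and weights *)

(** By induction: the mean of n + 1 points is the combination, with coefficients
1 / (n + 1) and n / (n + 1), of the first point and the mean of the others. *)
Lemma convex_mean (R : realType) (V : lmodType R) (S : set V) (I : finType)
    (y : I -> V) (A : {set I}) :
  convex_set (S : set (convex_lmodType V)) -> (0 < #|A|)%N ->
  (forall i, S (y i)) -> S ((#|A|%:R : R)^-1 *: \sum_(i in A) y i).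
Proof.
move=> S_cvx A_gt0 yS; rewrite cardE -big_enum /=.
have : (0 < size (enum A))%N by rewrite -cardE.
elim: (enum A) => // i [|j r] IHr _; first by rewrite big_seq1 invr1 scale1r.
rewrite big_cons; set n := size (j :: r) in IHr *; rewrite -/n.
set v := \sum_(k <- _) _ in IHr *.
have n1_gt0 : 0 < n.+1%:R :> R by rewrite ltr0n.
have t_ge0 : 0 <= (n.+1%:R : R)^-1 by rewrite invr_ge0 ltW.
have t_le1 : (n.+1%:R : R)^-1 <= 1 by rewrite invf_le1// ler1n.
pose t : {i01 R} := Itv01 t_ge0 t_le1.
have := S_cvx (y i) ((n%:R : R)^-1 *: v) t; rewrite !in_setE.
move=> /(_ (yS i) (IHr isT)); congr S; rewrite /conv /= scalerDr scalerA.
congr (_ + _ *: _).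
rewrite -[(size r).+2]/n.+1 /unstable.onem -[n.+1]addn1 natrD.
have n_neq0 : (n%:R : R) != 0 by rewrite pnatr_eq0.
have : (n%:R : R) + 1 != 0 by rewrite -natr1 in n1_gt0; rewrite gt_eqF.
by move=> ?; field; apply/andP.
Qed.

Lemma weight_sum1 (R : realType) (N K : nat) (C : 'I_K -> {set 'I_N}) :
  (0 < N)%N -> is_clustering C -> \sum_(k < K) weight R (C k) = 1.
Proof.
move=> N_gt0 [_ C_disj C_cover].
rewrite /weight -mulr_suml -natr_sum.
suff -> : (\sum_(k < K) #|C k|)%N = N by rewrite mulfV// pnatr_eq0 -lt0n.
under eq_bigr do rewrite -sum1_card big_mkcond /=.
rewrite exchange_big /= -[RHS]card_ord -sum1_card; apply: eq_bigr => i _.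
have [k ik] := C_cover i; rewrite (bigD1 k)//= ik big1 ?addn0// => l lk.
by case: ifPn => // il; rewrite (C_disj _ _ _ il ik) eqxx in lk.
Qed.

(** * Arbitrary norms on row vectors *)

Section norms.
Variable R : realType.

Lemma is_norm0 (V : lmodType R) (nrm : V -> R) : is_norm nrm -> nrm 0 = 0.
Proof. by case=> _ nZ _; rewrite -[X in nrm X](scale0r 0) nZ normr0 mul0r. Qed.

Lemma is_normN (V : lmodType R) (nrm : V -> R) u :
  is_norm nrm -> nrm (- u) = nrm u.
Proof. by case=> _ nZ _; rewrite -scaleN1r nZ normrN normr1 mul1r. Qed.

Lemma is_norm_ge0 (V : lmodType R) (nrm : V -> R) u : is_norm nrm -> 0 <= nrm u.
Proof.
move=> nP; have [nD _ _] := nP.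
by have := nD u (- u); rewrite subrr is_norm0// is_normN//; lra.
Qed.

Lemma is_norm_dist (V : lmodType R) (nrm : V -> R) u v :
  is_norm nrm -> `|nrm u - nrm v| <= nrm (u - v).
Proof.
move=> nP; have [nD _ _] := nP; rewrite ler_norml.
have := nD (u - v) v; have := nD (v - u) u.
by rewrite !subrK -[v - u]opprB is_normN// => *; apply/andP; split; lra.
Qed.

Lemma is_norm_sum (V : lmodType R) (nrm : V -> R) (I : Type) (r : seq I)
    (F : I -> V) :
  is_norm nrm -> nrm (\sum_(i <- r) F i) <= \sum_(i <- r) nrm (F i).
Proof.
move=> nP; have [nD _ _] := nP; elim/big_ind2 : _ => [|a b c d ab cd|//].
  by rewrite is_norm0.
by apply: le_trans (nD _ _) _; apply: lerD.
Qed.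

Variables (m : nat) (nrm : 'rV[R]_m -> R).
Hypothesis nP : is_norm nrm.

Lemma is_norm_le_mx_norm u :
  nrm u <= (\sum_(j < m) nrm (delta_mx 0 j)) * `|u|.
Proof.
have [_ nZ _] := nP.
rewrite {1}[u]row_sum_delta mulr_suml.
apply: le_trans (is_norm_sum _ _ nP) _; apply: ler_sum => j _.
rewrite nZ mulrC ler_wpM2l ?is_norm_ge0// [leRHS]mx_normrE.
by apply: (le_bigmax _ (fun ij : 'I_1 * 'I_m => `|u ij.1 ij.2|) (0, j)).
Qed.

Lemma is_norm_continuous : continuous nrm.
Proof.
move=> u; set M := \sum_(j < m) nrm (delta_mx 0 j).
have M_ge0 : 0 <= M by apply: sumr_ge0 => j _; exact: is_norm_ge0.
apply/(@cvgrPdist_lt _ _ _ (nbhs u)) => e e_gt0; near=> v.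
apply: le_lt_trans (is_norm_dist _ _ nP) _.
apply: le_lt_trans (is_norm_le_mx_norm _) _; rewrite -/M.
(* M may vanish (in dimension 0), so the Lipschitz constant is taken M + 1. *)
apply: (@le_lt_trans _ _ ((M + 1) * `|u - v|)).
  by rewrite ler_wpM2r// lerDl.
rewrite mulrC -ltr_pdivlMr ?ltr_wpDl//.
near: v; apply: (@cvgr_dist_lt _ _ _ (nbhs u) _ id u); first exact: cvg_id.
by rewrite divr_gt0// ltr_wpDl.
Unshelve. all: by end_near. Qed.

(** The nontrivial half of the equivalence of norms: c is the minimum of [nrm]
on the compact unit sphere of the sup norm. *)
Lemma mx_norm_le_is_norm : exists2 c, 0 < c & forall u, c * `|u| <= nrm u.
Proof.
have [_ nZ nI] := nP.
pose A := [set u : 'rV[R]_m | `|u| = 1].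
have cA : compact A.
  apply: bounded_closed_compact.
    by exists 1; split => // M M1 u /= ->; exact: ltW.
  rewrite (_ : A = (fun u => `|u|) @^-1` [set 1])//.
  by apply: closed_comp => [u _|]; [exact: norm_continuous|exact: closed_eq].
(* In dimension 0 the sphere is empty, and any constant will do. *)
have [[u0 Au0]|] := pselect (A !=set0); last first.
  move=> /nonemptyPn A0; exists 1 => // u; rewrite mul1r.
  have [->|u_neq0] := eqVneq u 0; first by rewrite normr0 is_norm0.
  suff : A (`|u|^-1 *: u) by rewrite A0.
  by rewrite /A/= normrZ normfV normr_id mulVf// normr_eq0.
have A0 : A !=set0 by exists u0.
have nrm_cont : {within A, continuous nrm}.
  by apply: continuous_subspaceT; exact: is_norm_continuous.
have [v /set_mem Av vmin] := compact_EVT_min A0 cA nrm_cont.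
exists (nrm v) => [|u].
  rewrite lt_neqAle is_norm_ge0// andbT eq_sym.
  apply/eqP => /nI v0; move: Av; rewrite /A/= v0 normr0 => /eqP.
  by rewrite eq_sym oner_eq0.
have [->|u_neq0] := eqVneq u 0; first by rewrite normr0 mulr0 is_norm_ge0.
have Au : A (`|u|^-1 *: u).
  by rewrite /A/= normrZ normfV normr_id mulVf// normr_eq0.
have := vmin _ (mem_set Au).
by rewrite nZ normfV normr_id ler_pdivlMl ?normr_gt0// mulrC.
Qed.

Lemma dist_continuous d : continuous (fun v : 'rV[R]_m => nrm (v - d)).
Proof.
move=> v; apply: (cvg_comp (fun u => u - d) nrm); last first.
  exact: is_norm_continuous.
by apply: (@cvgB _ _ _ (nbhs v)); [exact: cvg_id|exact: cvg_cst].
Qed.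

Lemma norm_ball_compact d e : compact [set v | nrm (v - d) <= e].
Proof.
have [c c_gt0 cn] := mx_norm_le_is_norm.
apply: bounded_closed_compact.
  exists (e / c + `|d|); split; first exact: num_real.
  move=> M M_gt v /= ved; apply/ltW/le_lt_trans/M_gt.
  rewrite -[v](subrK d); apply: le_trans (ler_normD _ _) _.
  by rewrite lerD2r ler_pdivlMr// mulrC (le_trans (cn _)).
rewrite (_ : mkset _ = (fun v => nrm (v - d)) @^-1` [set r | r <= e])//.
apply: closed_comp => [v _|]; last exact: closed_le.
exact: dist_continuous.
Qed.

End norms.

(** * Balls that contain the points within budget *)

Section reach.
Variable R : realType.
Implicit Types (w e a : R) (p : nat).

(** The radius r that solves [w * r ^+ p = e ^+ p]: the farthest that a point of
weight w can go when it spends the whole budget. *)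
Definition reach w e p : R := e * w `^ (- (p%:R)^-1).

Lemma reach_ge0 w e p : 0 <= e -> 0 <= reach w e p.
Proof. by move=> e_ge0; rewrite mulr_ge0// powR_ge0. Qed.

Lemma reachX w e p : 0 < w -> (0 < p)%N -> w * reach w e p ^+ p = e ^+ p.
Proof.
move=> w_gt0 p_gt0; rewrite exprMn -[in LHS](powR_mulrn _ (powR_ge0 _ _)).
rewrite -powRrM mulNr mulVf ?pnatr_eq0 -?lt0n// powRN powRr1 ?ltW//.
by rewrite mulrCA mulfV ?mulr1// gt_eqF.
Qed.

Lemma le_reach w e a p : 0 < w -> 0 <= e -> 0 <= a -> (0 < p)%N ->
  w * a ^+ p <= e ^+ p -> a <= reach w e p.
Proof.
move=> w_gt0 e_ge0 a_ge0 p_gt0; rewrite -(reachX e w_gt0 p_gt0) ler_pM2l//.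
by rewrite ler_pXn2r// nnegrE reach_ge0.
Qed.

Lemma cvg_reach w e : 0 < w -> reach w e p @[p --> \oo] --> e.
Proof.
move=> w_gt0; rewrite -[X in _ --> X]mulr1.
apply: cvgM; first exact: cvg_cst.
have -> : (fun p => w `^ (- p%:R^-1)) = (fun p => expR (- p%:R^-1 * ln w)).
  by apply/funext => p; rewrite /powR gt_eqF.
rewrite -[X in _ --> X]expR0; apply: continuous_cvg.
  exact: continuous_expR.
rewrite -[X in _ --> X](mul0r (ln w)); apply: cvgM; last exact: cvg_cst.
rewrite -[X in _ --> X]oppr0; apply: cvgN.
by rewrite -cvg_shiftS; exact: cvg_harmonic.
Qed.

End reach.

(** * Maxima over the balls and over the clustered set *)

Section maxima.
Variables (R : realType) (m n : nat) (nrm : 'rV[R]_m -> R).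
Hypothesis nrmP : is_norm nrm.
Variables (S : set 'rV[R]_m) (g : 'rV[R]_m -> 'rV[R]_n -> \bar R).
Variable x : 'rV[R]_n.
Hypotheses (S_closed : closed S) (g_lty : forall u, (g u x < +oo)%E).
Hypothesis g_gtNy : forall u, S u -> (-oo < g u x)%E.
Hypothesis g_usc : lower_semicontinuous (fun u => - g u x)%E.

Lemma ball_attained d e :
  S d -> 0 <= e -> attained (ball_values nrm S g d x e).
Proof.
move=> Sd e_ge0; apply: (@attained_usc _ _ _ (g^~ x)) => //.
  by exists d; split; rewrite // subrr is_norm0.
apply: (@subclosed_compact _ _ [set v | nrm (v - d) <= e]).
- apply: closedI => //; apply: closed_comp (@closed_le R e) => v _.
  exact: dist_continuous.
- exact: norm_ball_compact.
- by move=> v [].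
Qed.

Lemma g_eps_fin_num d e :
  S d -> 0 <= e -> g_eps nrm S g d x e \is a fin_num.
Proof.
move=> Sd /(ball_attained Sd); rewrite /attained -/(g_eps _ _ _ _ _ _).
by move=> [v [Sv _] <-]; rewrite fin_numElt g_gtNy// g_lty.
Qed.

Variables (K : nat) (w : 'I_K -> R) (d : 'I_K -> 'rV[R]_m) (eps : R).
Hypotheses (w_gt0 : forall k, 0 < w k) (w_sum1 : \sum_(k < K) w k = 1).
Hypotheses (S_d : forall k, S (d k)) (eps_gt0 : 0 < eps).

Lemma wg_lty k u : ((w k)%:E * g u x < +oo)%E.
Proof.
have := g_lty u; case: (g u x) => [r| |] // _; first by rewrite -EFinM ltry.
by rewrite gt0_muleNy ?lte_fin.
Qed.

(** The other terms of the budget are nonnegative. *)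
Lemma budget_le_reach (p : nat) (v : 'I_K -> 'rV[R]_m) k : (0 < p)%N ->
  \sum_(k < K) w k * nrm (v k - d k) ^+ p <= eps ^+ p ->
  nrm (v k - d k) <= reach (w k) eps p.
Proof.
move=> p_gt0 v_le; apply: le_reach => //; [exact: ltW|exact: is_norm_ge0|].
apply: le_trans v_le; rewrite (bigD1 k)//= lerDl sumr_ge0// => j _.
by rewrite mulr_ge0 ?exprn_ge0// ?is_norm_ge0// ltW.
Qed.

(* Families of points get the product topology. *)
Import ArrowAsProduct.

Lemma budget_continuous p : continuous
  (fun v : 'I_K -> 'rV[R]_m => \sum_(k < K) w k * nrm (v k - d k) ^+ p).
Proof.
apply: continuous_big => [|k _ v].
  exact: add_continuous.
apply: (cvg_comp (fun v : 'I_K -> 'rV[R]_m => nrm (v k - d k))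
  (fun r : R => w k * r ^+ p)); last first.
  set r := (nrm _); apply: (@cvgM _ _ (nbhs r) _ (cst (w k)) (fun r => r ^+ p)).
    exact: cvg_cst.
  exact: exprn_continuous.
apply: (cvg_comp (fun v : 'I_K -> 'rV[R]_m => v k)
  (fun u => nrm (u - d k))); last exact: dist_continuous.
exact: (@proj_continuous 'I_K (fun=> 'rV[R]_m) k v).
Qed.

Lemma clustered_attained p :
  (0 < p)%N -> attained (clustered_values nrm S g w d eps x p).
Proof.
move=> p_gt0.
apply: (@attained_usc _ ('I_K -> 'rV[R]_m) _
  (fun v => \sum_(k < K) (w k)%:E * g (v k) x)%E) => //.
- (* The family d itself is within budget; this needs 0 ^+ p = 0. *)
  exists d; split => //; rewrite big1 ?exprn_ge0 ?ltW// => k _.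
  by rewrite subrr is_norm0// expr0n gtn_eqF// mulr0.
- pose B k := [set v | nrm (v - d k) <= reach (w k) eps p].
  apply: (@subclosed_compact _ _
    [set v : 'I_K -> 'rV[R]_m | forall k, B k (v k)]).
  + apply: closedI.
      by apply: closed_comp (@closed_le R _) => v _; exact: budget_continuous.
    have -> : (fun v : 'I_K -> 'rV[R]_m => forall k, S (v k)) =
        \bigcap_k (fun v : 'I_K -> 'rV[R]_m => v k) @^-1` S.
      by apply/seteqP; split => v Sv k; [move=> _; exact: Sv|exact: Sv].
    apply: closed_bigI => k _; apply: closed_comp S_closed => v _.
    exact: (@proj_continuous 'I_K (fun=> 'rV[R]_m) k v).
  + by apply: tychonoff => k; exact: norm_ball_compact.
  + by move=> v [v_le _] k; exact: budget_le_reach.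
- (* Pulling the sign through the sum is legitimate since no term is +oo. *)
  have -> : (fun v : 'I_K -> 'rV[R]_m => - \sum_(k < K) (w k)%:E * g (v k) x)%E
    = (fun v => \sum_(k < K) (w k)%:E * - g (v k) x)%E.
    apply/funext => v; rewrite -sumeN => [|i j _ _].
      by apply: eq_bigr => k _; rewrite muleN.
    by apply: ltpinfty_adde_def; rewrite inE wg_lty.
  apply: lsc_sum => k; apply: lsc_scale => //.
  apply: (@lsc_comp _ _ _ (fun v : 'I_K -> 'rV[R]_m => v k)
    (fun u => - g u x)%E) => //.
  exact: (@proj_continuous 'I_K (fun=> 'rV[R]_m) k).
Qed.

Lemma g_bar_le p : (0 < p)%N ->
  (g_bar nrm S g w d eps x p <=
   \sum_(k < K) (w k)%:E * g_eps nrm S g (d k) x (reach (w k) eps p))%E.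
Proof.
move=> p_gt0; apply: ge_ereal_sup => _ [v [v_le Sv] <-].
apply: lee_sum => k _; rewrite lee_pmul2l ?lte_fin//.
apply: ereal_sup_ubound; exists (v k) => //; split => //.
exact: budget_le_reach.
Qed.

(** Maximisers over the K balls form a family within budget, because the weights
sum to 1. *)
Lemma g_bar_ge p :
  (\sum_(k < K) (w k)%:E * g_eps nrm S g (d k) x eps <=
   g_bar nrm S g w d eps x p)%E.
Proof.
have /choice[v vP] : forall k, exists u,
    (S u /\ nrm (u - d k) <= eps) /\ g u x = g_eps nrm S g (d k) x eps.
  by move=> k; have [u ? ?] := ball_attained (S_d k) (ltW eps_gt0); exists u.
under eq_bigr => k _ do rewrite -(vP k).2.
apply: ereal_sup_ubound; exists v => //; split; last first.
  by move=> k; have [[]] := vP k.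
rewrite -[leRHS]mul1r -w_sum1 mulr_suml; apply: ler_sum => k _.
rewrite ler_pM2l// lerXn2r ?nnegrE ?is_norm_ge0 ?(ltW eps_gt0)//.
by have [[]] := vP k.
Qed.

Lemma cvg_g_bar :
  (forall k, {in `]0, +oo[, continuous (g_eps nrm S g (d k) x)}) ->
  g_bar nrm S g w d eps x p @[p --> \oo]
    --> (\sum_(k < K) (w k)%:E * g_eps nrm S g (d k) x eps)%E.
Proof.
move=> g_cont.
have sum_cvg : (\sum_(k < K) (w k)%:E *
      g_eps nrm S g (d k) x (reach (w k) eps p))%E @[p --> \oo] -->
    (\sum_(k < K) (w k)%:E * g_eps nrm S g (d k) x eps)%E.
  apply: cvge_sum => k; first by rewrite fin_numM// g_eps_fin_num// ltW.
  apply: cvgeZl => //; apply: (cvg_comp (fun p => reach (w k) eps p)).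
    exact: cvg_reach.
  by apply: g_cont; rewrite in_itv/= eps_gt0.
apply: squeeze_cvge (cvg_cst _) sum_cvg.
by near=> p; rewrite g_bar_ge g_bar_le//; near: p; exact: nbhs_infty_gt.
Unshelve. all: by end_near. Qed.

End maxima.

(** * The limit *)

Theorem theoremA1 (R : realType) (m n N K : nat)
  (nrm : 'rV[R]_m -> R) (hnrm : is_norm nrm)
  (S : set 'rV[R]_m) (S_convex : convex_set S) (S_closed : closed S)
  (X : set 'rV[R]_n) (X_compact : compact X)
  (g : 'rV[R]_m -> 'rV[R]_n -> \bar R)
  (g_proper : forall x, X x -> proper_efun (fun u => - g u x)%E)
  (g_convex : forall x, X x -> convex_efun (fun u => - g u x)%E)
  (g_lsc : forall x, X x -> lower_semicontinuous (fun u => - g u x)%E)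
  (g_dom : forall x, X x -> S `<=` edom (fun u => - g u x)%E)
  (eps : R) (eps_gt0 : 0 < eps)
  (N_gt0 : (0 < N)%N) (y : 'I_N -> 'rV[R]_m) (y_S : forall i, S (y i))
  (C : 'I_K -> {set 'I_N}) (hC : is_clustering C) :
  let d (k : 'I_K) := centroid y (C k) in
  let w (k : 'I_K) := weight R (C k) in
  forall x, X x ->
  (forall k, {in `]0, +oo[, continuous (g_eps nrm S g (d k) x)}) ->
  [/\ forall k e, 0 < e -> attained (ball_values nrm S g (d k) x e),
      forall p, (1 <= p)%N -> attained (clustered_values nrm S g w d eps x p)
    & g_bar nrm S g w d eps x p @[p --> \oo]
        --> (\sum_(k < K) (w k)%:E * g_eps nrm S g (d k) x eps)%E].
Proof.
move=> d w x Xx g_cont.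
have [g_gt _] := g_proper _ Xx.
have g_lty u : (g u x < +oo)%E by have := g_gt u; rewrite lteNr.
have g_gtNy u : S u -> (-oo < g u x)%E.
  by move=> /(g_dom _ Xx); rewrite /edom/= lteNl.
have [C_gt0 _ _] := hC.
have w_gt0 k : 0 < w k by rewrite divr_gt0 ?ltr0n.
have w_sum1 : \sum_(k < K) w k = 1 := weight_sum1 R N_gt0 hC.
have S_d k : S (d k) by exact: convex_mean.
have g_usc := g_lsc _ Xx.
split=> [k e e_gt0|p p_gt0|].
- exact: ball_attained (ltW e_gt0).
- exact: clustered_attained.
- exact: cvg_g_bar.
Qed.
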